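(* Let $n>5$ be an integer, let $S_n$ be the symmetric group on $n$ letters, and let $\alpha,\beta\in S_n\setminus\{e\}$. Then $\eta(\alpha^{S_n}\beta^{S_n})\ge 2$. Moreover, if $\eta(\alpha^{S_n}\beta^{S_n})=2$, then at least one of $\alpha$, $\beta$ is a fixed point free permutation; and if $\eta(\alpha^{S_n}\beta^{S_n})=2$ and $\alpha$ is fixed point free, then one of the following holds: (i) $n$ is even, $\alpha$ is the product of $\frac{n}{2}$ disjoint transpositions, and $\beta$ is either a transposition or a $3$-cycle; (ii) $n$ is a multiple of $3$, $\alpha$ is the product of $\frac{n}{3}$ disjoint $3$-cycles, and $\beta$ is a transposition.
   Context: For a finite group $G$ and $a\in G$, $a^G=\{g^{-1}ag\mid g\in G\}$ is the conjugacy class of $a$ in $G$, and for $a,b\in G$, $a^Gb^G=\{xy\mid x\in a^G,\ y\in b^G\}$. This set is invariant under conjugation by $G$, so it is a union of conjugacy classes; $\eta(a^Gb^G)$ denotes the number of distinct conjugacy classes of $G$ contained in it. The identity element is $e$. $S_n$ is identified with the group of bijections of $\{1,\dots,n\}$; a permutation is fixed point free if it fixes no element of $\{1,\dots,n\}$. *)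

(* Defs.v *)
From mathcomp Require Import all_boot all_fingroup.

Set Implicit Arguments.
Unset Strict Implicit.
Unset Printing Implicit Defensive.

Local Open Scope group_scope.

(* For a, b in G the pointwise product (a ^: G) * (b ^: G) is a union of
   conjugacy classes of G. *)
Definition eta (gT : finGroupType) (G : {group gT}) (a b : gT) : nat :=
  #|[set C in classes G | C \subset (a ^: G) * (b ^: G)]|.

Definition fixed_point_free (T : finType) (s : {perm T}) : Prop :=
  forall x, s x != x.

Definition moved (T : finType) (s : {perm T}) : {set T} := [set x | s x != x].

Definition is_transposition (T : finType) (s : {perm T}) : Prop :=
  exists x y, x != y /\ s = tperm x y.

(* [next c] sends each entry of c to the following one, cyclically, and fixes
   all other points. *)
Definition is_cycle (k : nat) (T : finType) (s : {perm T}) : Prop :=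
  exists c : k.-tuple T, uniq c /\ s =1 next c.

Definition disjoint_product (m : nat) (T : finType)
    (P : {perm T} -> Prop) (s : {perm T}) : Prop :=
  exists t : 'I_m -> {perm T},
    [/\ forall i, P (t i),
        forall i j, i != j -> [disjoint moved (t i) & moved (t j)]
      & s = \prod_(i < m) t i].

(* Main.v *)
(* The number of fixed points of alpha * beta^g is the number agr of points at
   which alpha and (beta^-1)^g agree, so distinct values of agr, as g varies, give
   distinct classes in the product. If only two values p < q occurred, every
   change of agr would be 0 or +-(q - p). Swapping two labels x, y in
   c = (beta^-1)^g only changes c at x, y, c^-1 x and c^-1 y, so the resulting
   change of agr can be prescribed by placing a few points; six points give
   enough room to realize two different nonzero changes, and hence three values,
   for all pairs except
   - the pairs in the conclusion of the theorem, and
   - a transposition with a permutation whose cycles all have length at least 3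
     and not all length 3, or types (2,2,2) and (3,3) in S_6. There the third
     class is found by looking also at the fixed points of the square of the
     product. *)

Require Import Defs.
From mathcomp Require Import all_boot all_fingroup.
Set Implicit Arguments.
Unset Strict Implicit.
Unset Printing Implicit Defensive.
Local Open Scope group_scope.

(** * Fresh points, relabelling and closing tactics *)

Lemma fresh (T : finType) (s : seq T) : size s < #|T| -> exists z, z \notin s.
Proof.
move=> lt_s; apply/existsP; rewrite -negb_forall; apply/negP => /forallP all_s.
have := leq_ltn_trans (card_size s) lt_s.
by rewrite ltnNge subset_leq_card //; apply/subsetP => z _; exact: all_s.
Qed.

Lemma full_seq (T : finType) (s : seq T) : uniq s -> #|T| <= size s -> forall z, z \in s.
Proof.
move=> us le_s z; apply: contraT => z_s.
have uzs : uniq (z :: s) by rewrite /= z_s.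
by have := leq_trans (max_card (mem (z :: s))) le_s; rewrite (card_uniqP uzs) ltnn.
Qed.

(** Conjugating by such a [g] puts chosen points of the cycles of a permutation at prescribed
    places. A permutation matching the tails is corrected by a transposition, which disturbs no
    entry of the tails because the lists have no repetitions. *)
Lemma relabel (T : finType) (s1 s2 : seq T) :
  uniq s1 -> uniq s2 -> size s1 = size s2 -> exists g : {perm T}, map g s1 = s2.
Proof.
elim: s1 s2 => [|x s1 IH] [|y s2] //=; first by exists 1.
move=> /andP[x_s1 us1] /andP[y_s2 us2] [eq_sz].
have [g def_s2] := IH _ us1 us2 eq_sz.
exists (g * tperm (g x) y); rewrite permM tpermL -[in RHS]def_s2.
congr (_ :: _); apply/eq_in_map => u u_s1; rewrite permM tpermD //.
  by apply: contraNneq x_s1 => /perm_inj ->.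
by apply: contraNneq y_s2 => ->; rewrite -def_s2 map_f.
Qed.

Lemma swapE (T : finType) (c : {perm T}) x y z : (c ^ tperm x y) z = tperm x y (c (tperm x y z)).
Proof. by rewrite conjgE tpermV !permM. Qed.

Ltac neqs := repeat match goal with
  | H : is_true (_ \notin _) |- _ => rewrite !inE ?negb_or in H
  | H : is_true (_ && _) |- _ => move/andP: H => [? ?]
  | H : is_true (_ != _) |- _ => move/eqP: H => H
  end.

(* Congruence closure with injectivity of permutations. *)
Ltac inj_close := try congruence;
  repeat (match goal with
  | H : context [fun_of_perm ?s ?z], K : context [fun_of_perm ?s ?w] |- _ =>
     lazymatch z with w => fail | _ => idtac end;
     assert_fails (have: z = w by congruence);
     have ?: z = w by (apply: (@perm_inj _ s); congruence)
  end; try congruence).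

Ltac tcases := rewrite ?swapE;
  match goal with |- context [fun_of_perm (tperm ?x ?y) (fun_of_perm ?c (fun_of_perm (tperm ?x ?y) ?z))] =>
  case: (tpermP x y z) => [?|?|? ?]; try congruence; case: tpermP => [?|?|? ?]; try congruence end.

(* [gain], [loss] and [loss_only] discharge the three hypotheses of [dropsP] below
   when the swapped permutation is [c ^ tperm x y], by cases on the position of the
   point relative to [x], [y], [c^-1 x] and [c^-1 y]. *)
Ltac gain := let z := fresh "z" in move=> z; tcases; let E := fresh in move=> E; inj_close.

Ltac loss := let z := fresh "z" in move=> z; rewrite !inE;
  repeat (case/orP); move/eqP=> ->; (split; [congruence | tcases; let E := fresh in move=> E; inj_close]).

Ltac loss_only := let z := fresh "z" in move=> z; tcases; let E := fresh in let F := fresh in move=> E F;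
   apply: contraT; rewrite !inE ?negb_or; let G := fresh in move=> G; neqs; exfalso; inj_close.

Ltac uniq_inj := rewrite /= ?inE ?negb_or; repeat (apply/andP; split); try done; apply/eqP; let E := fresh in move=> E; inj_close.

Lemma conj_val (T : finType) (c g : {perm T}) u v u' v' :
  g u = u' -> g v = v' -> c u = v -> (c ^ g) u' = v'.
Proof. by move=> <- <- <-; rewrite permJ. Qed.

Ltac cval := solve [eapply conj_val; [eassumption | eassumption | congruence]].

(** * Agreement numbers *)

Section Agreement.
Variable T : finType.
Implicit Types a b c g h : {perm T}.

Definition agr a c := #|[set z | a z == c z]|.

Definition drops k a c := exists g h, agr a (c ^ g) = agr a (c ^ h) + k.

Definition drops_ge k a c := exists g h, agr a (c ^ h) + k <= agr a (c ^ g).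

(* Witnesses three values of [agr a (c ^ g)]. *)
Definition distinct_drops a c := exists2 k, 0 < k & drops k a c /\ drops_ge k.+1 a c.

Lemma agrC a c : agr a c = agr c a.
Proof. by apply: eq_card => z; rewrite !inE eq_sym. Qed.

Lemma agrJ a c g : agr (a ^ g) (c ^ g) = agr a c.
Proof.
rewrite -[RHS](card_imset _ (@perm_inj _ g)); apply: eq_card => z.
apply/idP/imsetP => [|[y]]; rewrite inE.
  move=> /eqP eq_z; exists (g^-1 z); rewrite ?permKV // inE.
  by apply/eqP/(@perm_inj _ g); rewrite -[LHS]permJ -[RHS]permJ permKV.
by move=> y_A ->; move: y_A; rewrite !inE !permJ => /eqP->.
Qed.

(** Conjugating both arguments by [g^-1] moves a relabelling from one argument to the other, so the
    notions of drop are symmetric. *)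
Lemma agr_swap_conj a c g : agr a (c ^ g) = agr c (a ^ g^-1).
Proof. by rewrite agrC -[LHS](agrJ _ _ g^-1) conjgK. Qed.

Lemma drops_sym k a c : drops k a c -> drops k c a.
Proof. by case=> g [h]; exists g^-1, h^-1; rewrite !(agr_swap_conj c) !invgK. Qed.

Lemma drops_ge_sym k a c : drops_ge k a c -> drops_ge k c a.
Proof. by case=> g [h le_gh]; exists g^-1, h^-1; rewrite !(agr_swap_conj c) !invgK. Qed.

Lemma distinct_drops_sym a c : distinct_drops a c -> distinct_drops c a.
Proof.
by case=> k k_gt0 [dk dk1]; exists k => //; split; [exact: drops_sym | exact: drops_ge_sym].
Qed.

Lemma drops_conj k a c g : drops k a (c ^ g) -> drops k a c.
Proof. by case=> h [h']; rewrite -!conjgM; exists (g * h), (g * h'). Qed.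

Lemma drops_ge_conj k a c g : drops_ge k a (c ^ g) -> drops_ge k a c.
Proof. by case=> h [h']; rewrite -!conjgM; exists (g * h), (g * h'). Qed.

Lemma drops_geW m k a c : m <= k -> drops_ge k a c -> drops_ge m a c.
Proof.
by move=> le_mk [g [h le_gh]]; exists g, h; apply: leq_trans le_gh; rewrite leq_add2l.
Qed.

Lemma drops_drops_ge k a c : drops k a c -> drops_ge k a c.
Proof. by case=> g [h eq_gh]; exists g, h; rewrite eq_gh. Qed.

(** Since nothing is gained, the agreements with [c ^ t] and the points of [s] are disjoint sets of
    agreements with [c]. The count is exact once [s] contains all the losses. *)
Lemma drops_geP a c t (s : seq T) : uniq s ->
    (forall z, a z = (c ^ t) z -> a z = c z) ->
    (forall z, z \in s -> a z = c z /\ a z <> (c ^ t) z) ->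
  drops_ge (size s) a c.
Proof.
move=> us no_gain s_sub; exists 1, t; rewrite conjg1.
rewrite -(card_uniqP us) /agr addnC.
rewrite -(cardsID [set z in s] [set z | a z == c z]) leq_add // subset_leq_card //.
  by apply/subsetP => z z_s; rewrite !inE z_s andbT; have [-> _] := s_sub z z_s.
apply/subsetP => z; rewrite !inE => /eqP eq_z.
rewrite (no_gain z eq_z) eqxx andbT.
by apply/negP => z_s; have [] := s_sub z z_s.
Qed.

Lemma dropsP a c t (s : seq T) : uniq s ->
    (forall z, a z = (c ^ t) z -> a z = c z) ->
    (forall z, z \in s -> a z = c z /\ a z <> (c ^ t) z) ->
    (forall z, a z = c z -> a z <> (c ^ t) z -> z \in s) ->
  drops (size s) a c.
Proof.
move=> us no_gain s_sub sub_s; exists 1, t; rewrite conjg1.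
rewrite -(card_uniqP us) /agr addnC.
rewrite -(cardsID [set z in s]); congr addn; apply: eq_card => z; rewrite !inE.
  by apply/andP/idP => [[]|z_s] //; have [-> _] := s_sub z z_s.
apply/andP/eqP => [[z_s /eqP eq_z] | eq_z].
  by apply/eqP; apply: contraR z_s => /eqP neq_z; apply: sub_s.
split; last by apply/eqP/no_gain.
by apply/negP => z_s; have [] := s_sub z z_s.
Qed.

(* In the lemmas [swap_*], [c] is relabelled by one transposition that destroys
   agreements with [a] without creating any. The point [s] may equal [p] here,
   which covers 3-cycles of [c]. *)
Lemma swap_path a c p q r s :
  q <> p -> r <> p -> r <> q -> a p = q -> c p = q -> c q = r -> c r = s ->
  a q <> r -> a q <> s -> a r <> s -> drops 1 a c.
Proof.
move=> qp rp rq ap cp cq cr aq aq' ar.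
by apply: (@dropsP a c (tperm q r) [:: p]); [| gain | loss | loss_only].
Qed.

(** Replacing the middle point of the common path [p -> q -> r] by the outside point [x] destroys
    both arrows. *)
Lemma swap_path3 a c p q r x :
  q <> p -> r <> p -> r <> q -> x <> p -> x <> q -> x <> r ->
  a p = q -> c p = q -> a q = r -> c q = r -> drops_ge 2 a c.
Proof.
move=> qp rp rq xp xq xr ap cp aq cq.
by apply: (@drops_geP a c (tperm q x) [:: p; q]); [uniq_inj | gain | loss].
Qed.

Lemma swap_path4 a c p q r s :
  uniq [:: p; q; r; s] ->
  a p = q -> c p = q -> c q = r -> c r = s -> a r = s -> drops_ge 2 a c.
Proof.
move=> /=; rewrite !inE !negb_or => H *; neqs.
by apply: (@drops_geP a c (tperm q r) [:: p; r]); [uniq_inj | gain | loss].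
Qed.

(** Swapping [x] and [y] turns the 2-cycles (x b)(y d) of [c] into (y b)(x d), so any agreement at
    these four points is lost. The two variants that follow fix which of the four are agreements. *)
Lemma swap_22 a c (x b y d : T) :
  uniq [:: x; b; y; d] ->
  c x = b -> c b = x -> c y = d -> c d = y ->
  a x = b -> a y = d -> a b <> y -> a d <> x -> drops_ge 2 a c.
Proof.
move=> /=; rewrite !inE !negb_or => H *; neqs.
by apply: (@drops_geP a c (tperm x y) [:: x; y]); [uniq_inj | gain | loss].
Qed.

Lemma swap_22_2 a c (x b y d : T) :
  uniq [:: x; b; y; d] ->
  c x = b -> c b = x -> c y = d -> c d = y ->
  a x = b -> a b = x -> a y <> d -> a d <> y -> drops 2 a c.
Proof.
move=> /=; rewrite !inE !negb_or => H *; neqs.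
by apply: (@dropsP a c (tperm x y) [:: x; b]); [uniq_inj | gain | loss | loss_only].
Qed.

Lemma swap_22_4 a c (x b y d : T) :
  uniq [:: x; b; y; d] ->
  c x = b -> c b = x -> c y = d -> c d = y ->
  a x = b -> a b = x -> a y = d -> a d = y -> drops_ge 4 a c.
Proof.
move=> /=; rewrite !inE !negb_or => H *; neqs.
by apply: (@drops_geP a c (tperm x y) [:: x; b; y; d]); [uniq_inj | gain | loss].
Qed.

Lemma swap_fix_2 a c x y d :
  uniq [:: x; y; d] -> c x = x -> c y = d -> c d = y ->
  a x <> x -> a y = d -> a d <> y -> a d <> x -> drops 1 a c.
Proof.
move=> /=; rewrite !inE !negb_or => H *; neqs.
by apply: (@dropsP a c (tperm x y) [:: y]); [uniq_inj | gain | loss | loss_only].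
Qed.

Lemma swap_fix_22 a c x y d :
  uniq [:: x; y; d] -> c x = x -> c y = d -> c d = y ->
  a x <> x -> a y = d -> a d = y -> drops_ge 2 a c.
Proof.
move=> /=; rewrite !inE !negb_or => H *; neqs.
by apply: (@drops_geP a c (tperm x y) [:: y; d]); [uniq_inj | gain | loss].
Qed.

(* The cycle of [c] through [y] may have length 2, with [d = e]. *)
Lemma swap_3_k a c p x q y d e :
  uniq [:: p; x; q; y] -> c p = x -> c x = q -> c d = y -> c y = e ->
  a x = q -> a q = x -> a p <> y -> a y <> e -> a d <> y ->
  d <> q -> d <> y -> d <> x -> e <> x -> drops 1 a c.
Proof.
move=> /=; rewrite !inE !negb_or => H *; neqs.
by apply: (@dropsP a c (tperm x y) [:: x]); [uniq_inj | gain | loss | loss_only].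
Qed.

(** The path [p -> q -> r] with [x] fixed becomes [p -> x -> r] with [q] fixed, and only the arrow
    at [p] was common. *)
Lemma swap_3_fix a c p q r x :
  uniq [:: p; q; r; x] -> c p = q -> c q = r -> c x = x ->
  a p = q -> a q <> r -> a q <> q -> a x <> r -> a x <> x -> drops 1 a c.
Proof.
move=> /=; rewrite !inE !negb_or => H *; neqs.
by apply: (@dropsP a c (tperm q x) [:: p]); [uniq_inj | gain | loss | loss_only].
Qed.

Lemma swap_fix_fix1 a c x y d e :
  c x = x -> a x = x -> c d = y -> c y = e -> a y <> y -> a y <> e -> a d <> y -> e <> y ->
  drops 1 a c.
Proof.
move=> *.
by apply: (@dropsP a c (tperm x y) [:: x]); [uniq_inj | gain | loss | loss_only].
Qed.

Lemma swap_fix_fix2 a c x y d :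
  c x = x -> a x = x -> c y = d -> a y = d -> y <> d -> drops_ge 2 a c.
Proof.
move=> *.
by apply: (@drops_geP a c (tperm x y) [:: x; y]); [uniq_inj | gain | loss].
Qed.

End Agreement.

(** * Realizing drops by relabelling *)

Section CaseAnalysis.
Variable T : finType.
Implicit Types a b c g h : {perm T}.

Definition inv2 a := forall z, a (a z) = z.
Definition inv3 a := forall z, a (a (a z)) = z.

Hypothesis T_gt5 : 5 < #|T|.

Lemma fresh5 (s : seq T) : size s <= 5 -> exists z, z \notin s.
Proof. by move=> le_s; apply: fresh; exact: leq_ltn_trans T_gt5. Qed.

(** Here [u] lies on a cycle of [c] of length at least 4. Four consecutive points of it are placed
    so that, of the first three arrows, only the one at [p] is shared with [a]. *)
Lemma drops1_long a c p u :
  a p <> p -> c (c u) <> u -> c (c (c u)) <> u -> drops 1 a c.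
Proof.
move=> ap u2 u3.
have [r rP] := @fresh5 [:: p; a p; a (a p)] isT.
have [s sP] := @fresh5 [:: p; a p; r; a (a p); a r] isT.
neqs.
have [|||g [g1 g2 g3 g4]] := @relabel T [:: u; c u; c (c u); c (c (c u))] [:: p; a p; r; s] => //.
- uniq_inj.
- uniq_inj.
apply: (drops_conj (g := g)).
apply: (@swap_path T a _ p (a p) r s) => //; try congruence; cval.
Qed.

Lemma drops1_3_3 a c p u :
  a (a p) <> p -> c (c u) <> u -> c (c (c u)) = u -> drops 1 a c.
Proof.
move=> ap u2 u3.
(* With this [r], the 3-cycle (p, a p, r) agrees with [a] at [p] but at neither of its other two
   points. *)
have [r rP] := @fresh5 [:: p; a p; a (a p); a^-1 p] isT.
neqs.
have ar : a r <> p by move=> ar; have := permK a r; rewrite ar; congruence.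
have [|||g [g1 g2 g3]] := @relabel T [:: u; c u; c (c u)] [:: p; a p; r] => //.
- uniq_inj.
- uniq_inj.
apply: (drops_conj (g := g)).
apply: (@swap_path T a _ p (a p) r p) => //; try congruence; try cval.
Qed.

Lemma drops_ge2_3_3 a c p u :
  a (a p) <> p -> c (c u) <> u -> drops_ge 2 a c.
Proof.
move=> ap u2.
have [x xP] := @fresh5 [:: p; a p; a (a p)] isT.
neqs.
have [|||g [g1 g2 g3]] := @relabel T [:: u; c u; c (c u)] [:: p; a p; a (a p)] => //.
- uniq_inj.
- uniq_inj.
apply: (drops_ge_conj (g := g)).
by apply: (@swap_path3 T a _ p (a p) (a (a p)) x) => //; try (by move=> ?; inj_close); cval.
Qed.

Lemma distinct_drops_3_3 a c p u :
  a (a p) <> p -> c (c u) <> u -> distinct_drops a c.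
Proof.
move=> ap u2; exists 1%N => //; split; last exact: (drops_ge2_3_3 ap u2).
have [u3 | u3] := eqVneq (c (c (c u))) u; first exact: (drops1_3_3 ap u2 u3).
by apply: (drops1_long (p := p) _ u2 (elimN eqP u3)) => ?; congruence.
Qed.

(** Aligning a fixed point of [c] with one of [a] and swapping it with [y] loses that common fixed
    point. The loss is exactly 1 if no arrow at [y] is common, and at least 2 if [y -> a y] is
    common as well. *)
Lemma distinct_drops_fix a c x y u v :
  a x = x -> c u = u -> a y <> y -> c v <> v -> distinct_drops a c.
Proof.
move=> ax cu ay cv; exists 1%N => //; split; last first.
  have [|||g [g1 g2 g3]] := @relabel T [:: u; v; c v] [:: x; y; a y] => //.
  - uniq_inj.
  - uniq_inj.
  apply: (drops_ge_conj (g := g)).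
  apply: (@swap_fix_fix2 T a _ x y (a y)) => //; try cval.
  by move=> ?; congruence.
have [v2 | /eqP v2] := eqVneq (c (c v)) v.
  have [e eP] := @fresh5 [:: x; y; a y; a^-1 y] isT.
  neqs.
  have ae : a e <> y by move=> ae; have := permK a e; rewrite ae; congruence.
  have [|||g [g1 g2 g3]] := @relabel T [:: u; v; c v] [:: x; y; e] => //.
  - uniq_inj.
  - uniq_inj.
  apply: (drops_conj (g := g)).
  by apply: (@swap_fix_fix1 T a _ x y e e) => //; try congruence; cval.
have [w cw] : exists w, c w = v by exists (c^-1 v); rewrite permKV.
have [d dP] := @fresh5 [:: x; y; a^-1 y] isT.
have [e eP] := @fresh5 [:: x; y; a y; d] isT.
neqs.
have ad : a d <> y by move=> ad; have := permK a d; rewrite ad; congruence.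
have [|||g [g1 g2 g3 g4]] := @relabel T [:: u; v; c v; w] [:: x; y; e; d] => //.
- uniq_inj.
- uniq_inj.
apply: (drops_conj (g := g)).
apply: (@swap_fix_fix1 T a _ x y d e) => //; try cval; try congruence.
Qed.

Lemma drops_ge2_long_22 a c u x y :
  c (c u) <> u -> c (c (c u)) <> u ->
  inv2 a -> a x <> x -> a y <> y -> y <> x -> y <> a x -> drops_ge 2 a c.
Proof.
move=> u2 u3 a2 ax ay yx yax; have aax := a2 x; have aay := a2 y.
have [|||g [g1 g2 g3 g4]] := @relabel T [:: u; c u; c (c u); c (c (c u))] [:: x; a x; y; a y] => //.
- uniq_inj.
- uniq_inj.
apply: (drops_ge_conj (g := g)).
apply: (@swap_path4 T a _ x (a x) y (a y)) => //; try cval.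
uniq_inj.
Qed.

Lemma drops_ge2_22 a c x y u v :
  inv2 c -> c u <> u -> c v <> v -> v <> u -> v <> c u ->
  a x <> x -> a y <> y -> y <> x -> y <> a x -> a y <> x -> a (a x) <> y -> a (a y) <> x ->
  drops_ge 2 a c.
Proof.
move=> c2 cu cv vu vcu ax ay yx yax ayx aax aay; have ccu := c2 u; have ccv := c2 v.
have [|||g [g1 g2 g3 g4]] := @relabel T [:: u; c u; v; c v] [:: x; a x; y; a y] => //.
- uniq_inj.
- uniq_inj.
apply: (drops_ge_conj (g := g)).
apply: (@swap_22 T a _ x (a x) y (a y)) => //; try cval.
uniq_inj.
Qed.

Lemma distinct_drops_22_22 a c x y u v :
  inv2 c -> c u <> u -> c v <> v -> v <> u -> v <> c u ->
  inv2 a -> a x <> x -> a y <> y -> y <> x -> y <> a x ->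
  distinct_drops a c.
Proof.
move=> c2 cu cv vu vcu a2 ax ay yx yax.
have ccu := c2 u; have ccv := c2 v; have aax := a2 x; have aay := a2 y.
(* Involutions that agree at a point also agree at its image, so the losses come in pairs: one
   common 2-cycle gives 2, two common 2-cycles give 4. *)
exists 2 => //; split.
  have [d dP] := @fresh5 [:: x; a x; y; a y] isT.
  neqs.
  have [|||g [g1 g2 g3 g4]] := @relabel T [:: u; c u; v; c v] [:: x; a x; y; d] => //.
  - uniq_inj.
  - uniq_inj.
  apply: (drops_conj (g := g)).
  apply: (@swap_22_2 T a _ x (a x) y d) => //; try cval.
  - uniq_inj.
  - congruence.
  by move=> ad; have := a2 d; congruence.
have [|||g [g1 g2 g3 g4]] := @relabel T [:: u; c u; v; c v] [:: x; a x; y; a y] => //.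
- uniq_inj.
- uniq_inj.
apply: (drops_ge_conj (g := g)).
apply: (@drops_geW T 3 4) => //.
apply: (@swap_22_4 T a _ x (a x) y (a y)) => //; try cval.
uniq_inj.
Qed.

Lemma drops1_fix_2 a c p u x :
  fixed_point_free a -> a (a p) <> p -> inv2 c -> c x = x -> c u <> u -> drops 1 a c.
Proof.
move=> a0 ap c2 cx cu; have ccu := c2 u.
have [x' xP] := @fresh5 [:: p; a p; a (a p)] isT.
have /eqP ax := a0 x'; have /eqP ap1 := a0 p.
neqs.
have [|||g [g1 g2 g3]] := @relabel T [:: x; u; c u] [:: x'; p; a p] => //.
- uniq_inj.
- uniq_inj.
apply: (drops_conj (g := g)).
apply: (@swap_fix_2 T a _ x' p (a p)) => //; try cval; try congruence.
uniq_inj.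
Qed.

Lemma drops_ge2_fix_2 a c p u x :
  fixed_point_free a -> a (a p) = p -> inv2 c -> c x = x -> c u <> u -> drops_ge 2 a c.
Proof.
move=> a0 ap c2 cx cu; have ccu := c2 u.
have [x' xP] := @fresh5 [:: p; a p] isT.
have /eqP ax := a0 x'; have /eqP ap1 := a0 p.
neqs.
have [|||g [g1 g2 g3]] := @relabel T [:: x; u; c u] [:: x'; p; a p] => //.
- uniq_inj.
- uniq_inj.
apply: (drops_ge_conj (g := g)).
apply: (@swap_fix_22 T a _ x' p (a p)) => //; try cval; try congruence.
uniq_inj.
Qed.

Lemma drops1_3_2 a c u v :
  inv2 a -> fixed_point_free a -> c (c u) <> u -> c (c (c u)) = u ->
  c v <> v -> c (c v) = v -> drops 1 a c.
Proof.
move=> a2 a0 u2 u3 cv v2.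
have [x _] := @fresh5 [::] isT.
have [p pP] := @fresh5 [:: x; a x] isT.
have [y yP] := @fresh5 [:: x; a x; p; a p] isT.
have [e eP] := @fresh5 [:: x; a x; p; y; a y] isT.
have /eqP ax := a0 x; have aax := a2 x; have aay := a2 y; have aap := a2 p; have aae := a2 e.
neqs.
have [|||g [g1 g2 g3 g4 g5]] := @relabel T [:: u; c u; c (c u); v; c v] [:: p; x; a x; y; e] => //.
- uniq_inj.
- uniq_inj.
apply: (drops_conj (g := g)).
apply: (@swap_3_k T a _ p x (a x) y e e) => //; try cval; try (by move=> ?; inj_close).
uniq_inj.
Qed.

(** The second 3-cycle of [c] goes to (y, e, d), and [d] has to avoid six points, whence the seventh
    letter. On six letters the corresponding pair is sporadic. *)
Lemma drops1_3_3_gt6 a c u v : 6 < #|T| ->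
  inv2 a -> fixed_point_free a -> c (c u) <> u -> c (c (c u)) = u ->
  c (c v) <> v -> c (c (c v)) = v -> v <> u -> v <> c u -> v <> c (c u) -> drops 1 a c.
Proof.
move=> T_gt6 a2 a0 u2 u3 v2 v3 vu vcu vccu.
have [x _] := @fresh5 [::] isT.
have [p pP] := @fresh5 [:: x; a x] isT.
have [y yP] := @fresh5 [:: x; a x; p; a p] isT.
have [e eP] := @fresh5 [:: x; a x; p; y; a y] isT.
have [d dP] := @fresh T [:: x; a x; p; y; a y; e] T_gt6.
have /eqP ax := a0 x; have aax := a2 x; have aay := a2 y; have aap := a2 p; have aae := a2 e.
have aad := a2 d.
neqs.
have [|||g [g1 g2 g3 g4 g5 g6]] := @relabel T [:: u; c u; c (c u); v; c v; c (c v)] [:: p; x; a x; y; e; d] => //.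
- uniq_inj.
- uniq_inj.
apply: (drops_conj (g := g)).
apply: (@swap_3_k T a _ p x (a x) y d e) => //; try cval; try (by move=> ?; inj_close).
uniq_inj.
Qed.

Lemma drops1_single3 a c u x :
  inv2 a -> fixed_point_free a -> c (c u) <> u -> c x = x -> drops 1 a c.
Proof.
move=> a2 a0 u2 cx.
have [p _] := @fresh5 [::] isT.
have [r rP] := @fresh5 [:: p; a p] isT.
have [x' xP] := @fresh5 [:: p; a p; r; a r] isT.
have /eqP ap := a0 p; have aap := a2 p; have aar := a2 r; have aax := a2 x'.
have /eqP ax := a0 x'.
neqs.
have [|||g [g1 g2 g3 g4]] := @relabel T [:: u; c u; c (c u); x] [:: p; a p; r; x'] => //.
- uniq_inj.
- uniq_inj.
apply: (drops_conj (g := g)).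
apply: (@swap_3_fix T a _ p (a p) r x') => //; try cval; try (by move=> ?; inj_close).
uniq_inj.
Qed.

(** * Case analysis on cycle types *)

Lemma fixed_or_free b : (exists z, b z = z) \/ fixed_point_free b.
Proof.
case: (pickP [pred z | b z == z]) => [z /eqP|no_fix]; first by left; exists z.
by right=> z; apply/negbT/no_fix.
Qed.

Lemma transpositionP a x : inv2 a -> a x <> x ->
  (exists y, [/\ a y <> y, y <> x & y <> a x]) \/ is_transposition a.
Proof.
move=> a2 ax; have aax := a2 x.
case: (pickP [pred y | [&& a y != y, y != x & y != a x]]) => [y | fix_a].
  by case/and3P=> /eqP ? /eqP ? /eqP ?; left; exists y.
right; exists x, (a x); split; first by rewrite eq_sym; apply/eqP.
apply/permP=> z; case: tpermP => [->|->|zx zax] //.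
have /= /negbT := fix_a z; rewrite !negb_and !negbK.
by case/or3P => /eqP.
Qed.

Lemma transposition_fix a : is_transposition a -> exists z, a z = z.
Proof.
case=> x [y [_ ->]]; have [z] := @fresh5 [:: x; y] isT.
by rewrite !inE negb_or !(eq_sym z) => /andP[? ?]; exists z; rewrite tpermD.
Qed.

Lemma is_cycle3 a u : a (a u) <> u -> a (a (a u)) = u ->
  (forall z, z \notin [:: u; a u; a (a u)] -> a z = z) -> is_cycle 3 a.
Proof.
move=> u2 u3 fix_a; exists [tuple u; a u; a (a u)]; split; first by uniq_inj.
move=> z /=; case: eqP => [-> //|zu]; case: eqP => [-> //|zau]; case: eqP => [->//|zaau].
by apply: fix_a; rewrite !inE !negb_or; apply/and3P; split; apply/eqP.
Qed.

(** These are the pairs of the conclusion before cycle decomposition: for a fixed point free [a],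
    [inv2 a] and [inv3 a] say that all cycles have length 2, respectively 3. *)
Definition exceptional a b :=
  fixed_point_free a /\
    (inv2 a /\ (is_transposition b \/ is_cycle 3 b) \/ inv3 a /\ is_transposition b).

(* The pairs outside the conclusion of the theorem for which [agr] may take only
   two values. *)
Definition sporadic a b :=
  fixed_point_free a /\
    ([/\ forall z, a (a z) <> z, exists z, a (a (a z)) <> z & is_transposition b]
     \/ [/\ #|T| = 6, inv2 a, fixed_point_free b & inv3 b]).

(** The last alternative keeps a positive drop because two classes must be exhibited for exceptional
    pairs too. *)
Definition trichotomy a c :=
  [\/ distinct_drops a c, sporadic a c \/ sporadic c a
    | drops_ge 1 a c /\ (exceptional a c \/ exceptional c a)].

Lemma trichotomy_sym a c : trichotomy a c -> trichotomy c a.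
Proof.
case=> [/distinct_drops_sym|[]|[/drops_ge_sym ? []]]; first [by constructor 1|by constructor 2; auto|by constructor 3; auto].
Qed.

Lemma trichotomy_inv2_has3 a c x u : inv2 a -> a x <> x -> c (c u) <> u -> trichotomy a c.
Proof.
move=> a2 ax u2; have cu : c u <> u by move=> cu; apply: u2; rewrite !cu.
have fix_fix : (exists z, a z = z) -> fixed_point_free c \/ trichotomy a c.
  case=> z az; case: (fixed_or_free c) => [[w cw]|]; last by left.
  by right; constructor 1; exact: (distinct_drops_fix az cw ax cu).
have [[y [ay yx yax]] | a_tr] := transpositionP a2 ax; last first.
  have a_fix := transposition_fix a_tr.
  case: (fix_fix a_fix) => // c0; case: a_fix => z az.
  have d1 := drops1_fix_2 c0 u2 a2 az ax.
  (* A transposition [a] against a fixed point free [c]: a 2-cycle of [c] yields a second, larger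
     drop. Without 2-cycles, the pair is exceptional if all cycles of [c] have length 3, and
     sporadic otherwise. *)
  case: (pickP [pred v | c (c v) == v]) => [v /eqP v2 | no2].
    constructor 1; apply: distinct_drops_sym; exists 1%N => //; split=> //.
    exact: (drops_ge2_fix_2 c0 v2 a2 az ax).
  case: (pickP [pred p | c (c (c p)) != p]) => [p /eqP p3 | c3].
    constructor 2; right; split=> //; left; split=> //; last by exists p.
    by move=> w /eqP; have /= -> := no2 w.
  constructor 3; split; first exact/drops_ge_sym/drops_drops_ge.
  right; split=> //; right; split=> // w.
  by apply/eqP; have /= /negbFE := c3 w.
(* Now [a] has at least two 2-cycles. A cycle of [c] of length at least 4 gives drops of 1 and at
   least 2, so that afterwards only cycles of length at most 3 remain. *)
case: (pickP [pred p | (c (c p) != p) && (c (c (c p)) != p)]) => [p | c4].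
  case/andP=> /eqP p2 /eqP p3; constructor 1; exists 1%N => //; split.
    exact: (drops1_long ax p2 p3).
  exact: (drops_ge2_long_22 p2 p3 a2 ax ay yx yax).
have c3 p : c (c p) <> p -> c (c (c p)) = p.
  by move=> /eqP p2; apply/eqP; have /= /negbT := c4 p; rewrite p2 negbK.
have u3 := c3 u u2.
(* Either [c] is a single 3-cycle, or it has a further nontrivial cycle, through [v], of length 2 or
   3. *)
case: (pickP [pred v | (c v != v) && (v \notin [:: u; c u; c (c u)])]) => [v | c_fix]; last first.
  have {}c_fix z : z \notin [:: u; c u; c (c u)] -> c z = z.
    by move=> z_u; apply/eqP; have /= /negbT := c_fix z; rewrite z_u andbT negbK.
  have [z /c_fix cz] := @fresh5 [:: u; c u; c (c u)] isT.
  case: (fixed_or_free a) => [a_fix | a0].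
    by case: (fix_fix a_fix) => // /(_ z); rewrite cz eqxx.
  constructor 3; split; first exact/drops_drops_ge/(drops1_single3 a2 a0 u2 cz).
  by left; split=> //; left; split=> //; right; exact: is_cycle3 c_fix.
case/andP=> /eqP cv v_u; neqs.
have v_dich : c (c v) = v \/ c (c (c v)) = v.
  by have [|/eqP] := eqVneq (c (c v)) v; [left | right; apply: c3].
have d2 : drops_ge 2 a c.
  apply: drops_ge_sym; apply: (drops_ge2_22 (x := u) (y := v) a2 ax ay yx yax) => //;
  by case: v_dich => ? ?; inj_close.
case: (fixed_or_free a) => [a_fix | a0].
  case: (fix_fix a_fix) => // c0; case: a_fix => z az.
  constructor 1; exists 1%N => //; split=> //.
  exact/drops_sym/(drops1_fix_2 c0 u2 a2 az ax).
have [v2 | v2] := eqVneq (c (c v)) v.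
  by constructor 1; exists 1%N => //; split=> //; exact: (drops1_3_2 a2 a0 u2 u3 cv v2).
move/eqP: v2 => v2; have v3 := c3 v v2.
(* There remain two 3-cycles of [c] against a fixed point free involution. On six letters the two
   3-cycles exhaust the points, which gives the sporadic pair. *)
move: T_gt5; rewrite leq_eqVlt => /orP[/eqP T6 | T_gt6]; last first.
  constructor 1; exists 1%N => //; split=> //.
  by apply: (drops1_3_3_gt6 T_gt6 a2 a0 u2 u3 v2 v3).
have all_T : forall z, z \in [:: u; c u; c (c u); v; c v; c (c v)].
  by apply: full_seq; [uniq_inj | rewrite -T6].
constructor 2; left; split=> //; right; split=> // z; have := all_T z; rewrite !inE;
  do ?case/orP; move=> /eqP ->; try congruence; apply/eqP => ?; inj_close.
Qed.

Lemma trichotomy_inv2_inv2 a c u :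
  fixed_point_free a -> inv2 a -> inv2 c -> c u <> u -> trichotomy a c.
Proof.
move=> a0 a2 c2 cu.
have [[v [cv vu vcu]] | c_tr] := transpositionP c2 cu.
  have [y] := @fresh5 [:: u; a u] isT.
  have /eqP au := a0 u; have /eqP ay := a0 y.
  move=> yP; neqs; constructor 1.
  exact: (distinct_drops_22_22 c2 cu cv vu vcu a2 au ay).
have [w cw] := transposition_fix c_tr.
constructor 3; split; last by left; split=> //; left; split=> //; left.
exact: (@drops_geW T 1 2) (drops_ge2_fix_2 a0 (a2 u) c2 cw cu).
Qed.

Lemma trichotomyP a c : a <> 1 -> c <> 1 -> trichotomy a c.
Proof.
have moves b : b <> 1 -> exists x, b x <> x.
  move=> b1; case: (pickP [pred x | b x != x]) => [x /eqP|fix_b]; first by exists x.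
  by case: b1; apply/permP=> x; rewrite perm1; apply/eqP; have /= /negbFE := fix_b x.
have has3P b : (exists x, b (b x) <> x) \/ inv2 b.
  case: (pickP [pred x | b (b x) != x]) => [x /eqP|fix_b]; first by left; exists x.
  by right=> x; apply/eqP; have /= /negbFE := fix_b x.
move=> /moves[x ax] /moves[u cu].
(* The split is by which of the two permutations have a cycle of length at least 3. *)
case: (has3P a) (has3P c) => [[y a2]|a2] [[v c2]|c2].
- by constructor 1; exact: (distinct_drops_3_3 a2 c2).
- exact/trichotomy_sym/(trichotomy_inv2_has3 c2 cu a2).
- exact: (trichotomy_inv2_has3 a2 ax c2).
case: (fixed_or_free a) => [[z az]|a0]; last exact: (trichotomy_inv2_inv2 a0 a2 c2 cu).
case: (fixed_or_free c) => [[w cw]|c0].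
  by constructor 1; exact: (distinct_drops_fix az cw ax cu).
exact/trichotomy_sym/(trichotomy_inv2_inv2 c0 c2 a2 ax).
Qed.

End CaseAnalysis.

(** * Conjugacy classes in the product *)

Section Eta.
Variable T : finType.
Implicit Types a b g s : {perm T}.
Let G := [set: {perm T}]%G.

Lemma class_mul_sub a b s : s \in (a ^: G) * (b ^: G) -> s ^: G \subset (a ^: G) * (b ^: G).
Proof.
case/mulsgP => _ _ /imsetP[g _ ->] /imsetP[h _ ->] ->.
apply/subsetP => _ /imsetP[k _ ->]; rewrite conjMg -!conjgM.
by rewrite mem_mulg // memJ_class // inE.
Qed.

(** The identity [x * y = y * x ^ y] shows that the two products of classes are the same set. *)
Lemma eta_sym a b : eta G a b = eta G b a.
Proof.
have sub x y : (x ^: G) * (y ^: G) \subset (y ^: G) * (x ^: G).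
  apply/subsetP => _ /mulsgP[_ _ /imsetP[g _ ->] /imsetP[h _ ->] ->].
  by rewrite conjgC -conjgM mem_mulg // memJ_class // inE.
have mulC : (a ^: G) * (b ^: G) = (b ^: G) * (a ^: G) :> {set {perm T}}.
  by apply/eqP; rewrite eqEsubset !sub.
by rewrite /eta mulC.
Qed.

Lemma size_le_eta a b (r : seq {perm T}) :
    {subset r <= (a ^: G) * (b ^: G)} ->
    pairwise (fun s u => s \notin u ^: G) r -> size r <= eta G a b.
Proof.
move=> r_sub r_neq; rewrite -(size_map (fun s => s ^: G)).
have ur : uniq (map (fun s => s ^: G) r).
  rewrite uniq_pairwise pairwise_map; apply: sub_pairwise r_neq => s u.
  by apply: contraNneq => /= <-; rewrite class_refl.
rewrite -(card_uniqP ur) subset_leq_card //; apply/subsetP => C /mapP[s s_r ->].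
by rewrite inE mem_classes ?inE //= class_mul_sub // r_sub.
Qed.

Lemma agr_eqn_notin a b g h : agr a (b^-1 ^ g) <> agr a (b^-1 ^ h) ->
  a * b ^ g \notin (a * b ^ h) ^: G.
Proof.
(* Fixed points are counted as agreements with the identity, so [agrJ] makes their number a class
   invariant. *)
have agrE k : agr a (b^-1 ^ k) = agr (a * b ^ k) 1.
  apply: eq_card => z; rewrite !inE conjVg permM perm1.
  by rewrite -(inj_eq (@perm_inj _ (b ^ k))) permKV.
move=> neq; apply/negP => /imsetP[k _ eqk]; case: neq; rewrite !agrE eqk.
by rewrite -[X in agr _ X](conj1g k) agrJ.
Qed.

Lemma mem_class_mul a b g : a * b ^ g \in (a ^: G) * (b ^: G).
Proof. by rewrite mem_mulg ?class_refl // memJ_class // inE. Qed.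

Lemma drops_eta a b k : 0 < k -> drops k a b^-1 -> 2 <= eta G a b.
Proof.
move=> k_gt0 [g [h eq_gh]].
apply: (@size_le_eta a b [:: a * b ^ g; a * b ^ h]).
  by move=> s; rewrite !inE => /orP[]/eqP->; exact: mem_class_mul.
rewrite /= andbT andbT; apply: agr_eqn_notin; rewrite eq_gh.
by apply/eqP; rewrite -[X in _ != X]addn0 eqn_add2l -lt0n.
Qed.

Lemma three_le_eta a b s1 s2 s3 :
    s1 \in (a ^: G) * (b ^: G) -> s2 \in (a ^: G) * (b ^: G) -> s3 \in (a ^: G) * (b ^: G) ->
    s1 \notin s2 ^: G -> s1 \notin s3 ^: G -> s2 \notin s3 ^: G -> 2 < eta G a b.
Proof.
move=> in1 in2 in3 n12 n13 n23; apply: (@size_le_eta a b [:: s1; s2; s3]).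
  by move=> s; rewrite !inE => /or3P[] /eqP->.
by rewrite /= n12 n13 n23.
Qed.

Lemma distinct_drops_eta a b : distinct_drops a b^-1 -> 2 < eta G a b.
Proof.
case=> k k_gt0 [[g [h eq_gh]] [g' [h' le_gh']]].
have distinct x y z : agr a (b^-1 ^ x) <> agr a (b^-1 ^ y) ->
    agr a (b^-1 ^ x) <> agr a (b^-1 ^ z) -> agr a (b^-1 ^ y) <> agr a (b^-1 ^ z) -> 2 < eta G a b.
  by move=> xy xz yz; apply: (@three_le_eta a b (a * b ^ x) (a * b ^ y) (a * b ^ z));
    rewrite ?mem_class_mul ?agr_eqn_notin.
have ne_gh : agr a (b^-1 ^ g) <> agr a (b^-1 ^ h).
  by move=> eq_hg; move: eq_gh k_gt0; rewrite eq_hg -[LHS]addn0 => /addnI <-.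
(* The values at [g'] and [h'] differ by more than [k], so one of them is neither the value at [g]
   nor the value at [h]. *)
have [Dg|/eqP Dg] := eqVneq (agr a (b^-1 ^ h')) (agr a (b^-1 ^ g)); last first.
  have [Dh|/eqP Dh] := eqVneq (agr a (b^-1 ^ h')) (agr a (b^-1 ^ h)).
    apply: (distinct g' g h) => // eq_g'; move: le_gh'; rewrite eq_g' Dh.
      by rewrite eq_gh leq_add2l ltnn.
    by rewrite -[X in _ <= X]addn0 leq_add2l.
  exact: (distinct h' g h).
apply: (distinct g' g h) => // eq_g'; move: le_gh'; rewrite eq_g' Dg.
  by rewrite -[X in _ <= X]addn0 leq_add2l.
by rewrite eq_gh -addnA -[X in _ <= X]addn0 leq_add2l addnS.
Qed.

(** * Fixed points of squares and the sporadic pairs *)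

Lemma fixes_notin s1 s2 : (exists z, s2 z = z) -> (forall z, s1 z <> z) -> s2 \notin s1 ^: G.
Proof.
move=> [z s2z] s1_free; apply/negP => /imsetP[g _ def_s2].
by apply: (s1_free (g^-1 z)); apply: (@perm_inj _ g); rewrite -[LHS]permJ -def_s2 permKV.
Qed.

(** Having a fixed point, and having a square with a fixed point, are class invariants. The three
    products have no cycle of length at most 2, a 2-cycle but no fixed point, and a fixed point. *)
Lemma fixes_square_eta a b g1 g2 g3 :
    (forall z, (a * b ^ g1) ((a * b ^ g1) z) <> z) ->
    (exists z, (a * b ^ g2) ((a * b ^ g2) z) = z) -> (forall z, (a * b ^ g2) z <> z) ->
    (exists z, (a * b ^ g3) z = z) ->
  2 < eta G a b.
Proof.
move=> free1 [z2 fix2] free2 [z3 fix3].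
have notin2 s1 s2 z : s2 (s2 z) = z -> (forall z, s1 (s1 z) <> z) -> s2 \notin s1 ^: G.
  move=> s2z s1_free; have := @fixes_notin (s1 * s1) (s2 * s2).
  move=> notin; apply/negP => /imsetP[g _ def_s2].
  have /negP[] : s2 * s2 \notin (s1 * s1) ^: G.
    by apply: notin => [|w]; [exists z; rewrite permM | rewrite permM; exact: s1_free].
  by apply/imsetP; exists g; rewrite ?inE // conjMg -def_s2.
apply: (@three_le_eta a b (a * b ^ g3) (a * b ^ g2) (a * b ^ g1)); rewrite ?mem_class_mul //.
- by apply: fixes_notin => //; exists z3.
- by apply: (notin2 _ _ z3) => //; rewrite !fix3.
exact: (notin2 _ _ z2).
Qed.

Lemma sporadic_eta a b : 5 < #|T| -> sporadic a b -> 2 < eta G a b.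
Proof.
move=> T_gt5 [a0 [[a2 [p a3] [x0 [y0 [x0y0 ->]]]]|[T6 a2 b0 b3]]].
  have neq0 : y0 <> x0 by apply/eqP; rewrite eq_sym.
  have conj_tp x y : x <> y -> exists g, tperm x0 y0 ^ g = tperm x y.
    move=> xy; have [|||g [g1 g2]] := @relabel T [:: x0; y0] [:: x; y] => //; try by uniq_inj.
    by exists g; rewrite tpermJ g1 g2.
  have /eqP ap := a0 p; have /= aap := a2 p.
  (* a * (p z) has a fixed point for z = a p, a 2-cycle but no fixed point for
     z = a (a p), and neither for z = y outside the five points below. *)
  have [y yP] := fresh5 T_gt5 (s := [:: p; a p; a (a p); a^-1 p; a^-1 (a^-1 p)]) isT.
  have [w ww] : exists w, a w = p by exists (a^-1 p); rewrite permKV.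
  have [v vv] : exists v, a v = w by exists (a^-1 (a^-1 p)); rewrite permKV -ww permK.
  have Ew : a^-1 p = w by rewrite -ww permK.
  have Ev : a^-1 w = v by rewrite -vv permK.
  rewrite Ew Ev in yP; neqs.
  have [|g1 e1] := conj_tp p y; first by congruence.
  have [|g2 e2] := conj_tp p (a (a p)); first by congruence.
  have [|g3 e3] := conj_tp p (a p); first by congruence.
  apply: (@fixes_square_eta _ _ g1 g2 g3); rewrite ?e1 ?e2 ?e3 ?permM.
  (* Multiplying by (p y) either joins two cycles of [a] or splits one into two pieces; these have
     length at least 3, since [y] is at distance at least 3 from [p] in both directions. *)
  - move: (a0 y) (a2 y) => /eqP ay aay; clear Ew Ev conj_tp e1 e2 e3 a3 g1 g2 g3.
    move=> z; rewrite !permM; move: (a0 z) (a2 z) => /eqP az aaz.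
    case: (tpermP p y (a z)) => [?|?|? ?]; case: tpermP => [?|?|? ?] ?;
    by clear a0 a2; inj_close.
  - exists p; rewrite !permM; case: (tpermP p (a (a p)) (a p)) => [//|eq_ap|_ _].
      by case: ap; apply: (@perm_inj _ a).
    by rewrite tpermR.
  (* A fixed point would require [a] to map one of [p], [a (a p)] to the other. The choice of [p]
     with [a (a (a p))] different from [p] excludes one direction, fixed point freeness the
     other. *)
  - by move=> z; rewrite permM; have /eqP := a0 z; case: tpermP => [?|?|? ?] az eq_z; clear a0 a2 conj_tp; inj_close.
  by exists p; rewrite permM tpermR.
(* In the case of six letters, [x1], [x2], [x3] represent the 2-cycles of [a], and [x1], [v] the
   3-cycles of [b]. *)
have [x1 _] := fresh5 T_gt5 (s := [::]) isT.
have [x2 x2P] := fresh5 T_gt5 (s := [:: x1; a x1]) isT.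
have [x3 x3P] := fresh5 T_gt5 (s := [:: x1; a x1; x2; a x2]) isT.
have [v vP] := fresh5 T_gt5 (s := [:: x1; b x1; b (b x1)]) isT.
have /eqP ax1 := a0 x1; have /eqP ax2 := a0 x2; have /eqP ax3 := a0 x3.
have aax1 := a2 x1; have aax2 := a2 x2; have aax3 := a2 x3.
have /eqP bx1 := b0 x1; have bbx1 := b3 x1; have /eqP bv := b0 v; have bbv := b3 v.
neqs.
have uniq_b : uniq [:: x1; b x1; b (b x1); v; b v; b (b v)] by uniq_inj.
have uniq_a : uniq [:: x1; x2; x3; a x1; a x2; a x3] by uniq_inj.
have a_all : forall z, z \in [:: x1; x2; x3; a x1; a x2; a x3].
  by apply: full_seq; rewrite // T6.
(* With a = (x1 y1)(x2 y2)(x3 y3), the three conjugates of b are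
   (x1 x2 x3)(y1 y2 y3), (x1 x2 x3)(y1 y3 y2) and (x1 y1 x2)(x3 y2 y3). *)
have [g1 [g11 g12 g13 g14 g15 g16]] := relabel uniq_b uniq_a erefl.
have [|g2 [g21 g22 g23 g24 g25 g26]] := @relabel T _ [:: x1; x2; x3; a x1; a x3; a x2] uniq_b _ erefl.
  by uniq_inj.
have [|g3 [g31 g32 _ _ _ _]] := @relabel T _ [:: x1; a x1; x2; x3; a x2; a x3] uniq_b _ erefl.
  by uniq_inj.
have b11 : (b ^ g1) x1 = x2 by cval.
have b12 : (b ^ g1) x2 = x3 by cval.
have b13 : (b ^ g1) x3 = x1 by cval.
have b14 : (b ^ g1) (a x1) = a x2 by cval.
have b15 : (b ^ g1) (a x2) = a x3 by cval.
have b16 : (b ^ g1) (a x3) = a x1 by cval.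
have b21 : (b ^ g2) x1 = x2 by cval.
have b22 : (b ^ g2) x2 = x3 by cval.
have b23 : (b ^ g2) x3 = x1 by cval.
have b24 : (b ^ g2) (a x1) = a x3 by cval.
have b25 : (b ^ g2) (a x3) = a x2 by cval.
have b26 : (b ^ g2) (a x2) = a x1 by cval.
have b31 : (b ^ g3) x1 = a x1 by cval.
move: (uniq_a); rewrite /= !inE !negb_or => a_neq; neqs.
apply: (@fixes_square_eta _ _ g1 g2 g3).
- move=> z; rewrite !(permM a); have := a_all z; rewrite !inE;
  by do ?case/orP; move=> /eqP ->; congruence.
- by exists x1; rewrite !(permM a); congruence.
- move=> z; rewrite !(permM a); have := a_all z; rewrite !inE;
  by do ?case/orP; move=> /eqP ->; congruence.
by exists (a x1); rewrite (permM a); congruence.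
Qed.
End Eta.

(** * Invariance of the special pairs under inversion *)

Section Inverse.
Variable T : finType.
Implicit Types a b : {perm T}.

Lemma fpfV a : fixed_point_free a -> fixed_point_free a^-1.
Proof. by move=> a0 z; rewrite -(inj_eq (@perm_inj _ a)) permKV eq_sym. Qed.

Lemma inv2V a : inv2 a -> inv2 a^-1.
Proof. by move=> a2 z; rewrite -{1}(a2 z) !permK. Qed.

Lemma inv3V a : inv3 a -> inv3 a^-1.
Proof. by move=> a3 z; rewrite -{1}(a3 z) !permK. Qed.

Lemma transpositionV a : is_transposition a -> is_transposition a^-1.
Proof. by case=> x [y [xy ->]]; exists x, y; rewrite tpermV. Qed.

Lemma cycleV k a : is_cycle k a -> is_cycle k a^-1.
Proof.
case=> c [uc a_next]; exists (rev_tuple c); rewrite rev_uniq; split=> // z.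
by apply: (@perm_inj _ a); rewrite permKV a_next /= next_rev // next_prev.
Qed.

Lemma exceptionalVl a b : exceptional a^-1 b -> exceptional a b.
Proof.
case=> /fpfV; rewrite invgK => a0 ab; split=> //.
by case: ab => -[]; [move/inv2V | move/inv3V]; rewrite invgK; [left | right].
Qed.

Lemma exceptionalVr a b : exceptional a b^-1 -> exceptional a b.
Proof.
case=> a0 ab; split=> //.
case: ab => -[a2]; last by move/transpositionV; rewrite invgK; right.
by case=> [/transpositionV|/cycleV]; rewrite invgK; left; split=> //; [left|right].
Qed.

Lemma sporadicVl a b : sporadic a^-1 b -> sporadic a b.
Proof.
case=> /fpfV; rewrite invgK => a0 ab; split=> //.
case: ab => [[a2 [z a3] b_tr]|[T6 a2 b0 b3]].
  left; split=> // [w aw|]; first by apply: (a2 w); rewrite -{1}aw !permK.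
  by exists z => az; apply: a3; rewrite -{1}az !permK.
by right; split=> //; move/inv2V: a2; rewrite invgK.
Qed.

Lemma sporadicVr a b : sporadic a b^-1 -> sporadic a b.
Proof.
case=> a0 ab; split=> //.
case: ab => [[a2 a3 /transpositionV]|[T6 a2 /fpfV + /inv3V]]; rewrite !invgK.
  by left.
by right.
Qed.
End Inverse.

(** * From drops to the number of classes *)

(** The trichotomy is applied to [a] and [b^-1], whose agreements count fixed points of the
    products. Sporadic pairs join the case of three classes, and inverses are removed from the
    exceptional ones. *)
Lemma eta_dichotomy (T : finType) (a b : {perm T}) :
    5 < #|T| -> a <> 1 -> b <> 1 ->
  2 < eta [set: {perm T}]%G a b \/
  1 < eta [set: {perm T}]%G a b /\ (exceptional a b \/ exceptional b a).
Proof.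
move=> T_gt5 a1 b1; have bV1 : b^-1 <> 1 by move=> bV; apply: b1; rewrite -[b]invgK bV invg1.
case: (trichotomyP T_gt5 a1 bV1) => [/distinct_drops_eta|[]|[ge1 exc]].
- by left.
- by move/sporadicVr/(sporadic_eta T_gt5); left.
- by move/sporadicVl/(sporadic_eta T_gt5); rewrite eta_sym; left.
right; split; last by case: exc => [/exceptionalVr|/exceptionalVl]; [left | right].
case: ge1 => g [h le_gh].
apply: (@drops_eta _ _ _ (agr a (b^-1 ^ g) - agr a (b^-1 ^ h))).
  by rewrite subn_gt0 -addn1.
by exists g, h; rewrite subnKC // (leq_trans _ le_gh) // leq_addr.
Qed.

(** * Cycle decompositions *)

Section Decomposition.
Variables (T : finType) (a : {perm T}).

Lemma porbit_restr x z :
  restr_perm (porbit a x) a z = if z \in porbit a x then a z else z.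
Proof.
have nSa : a \in 'N(porbit a x | 'P).
  rewrite porbitE -cycle_subG; apply: (acts_orbit _ x (subsetT <[a]>)).
case: ifP => [z_x|/negbT z_x]; first exact: restr_permE.
by rewrite (out_perm (restr_perm_on _ _)).
Qed.

Lemma card_porbit_seq x (s : seq T) : uniq s -> x \in s ->
  (forall z, z \in s -> a z \in s) -> {subset s <= porbit a x} -> #|porbit a x| = size s.
Proof.
move=> us x_s s_a s_sub; rewrite -(card_uniqP us); apply: eq_card => z.
apply/idP/idP => [/porbitP[i ->]|]; last exact: s_sub.
by elim: i => [|i IH]; rewrite ?perm1 // expgSr permM s_a.
Qed.

Lemma porbits_partition : partition (porbits a) [set: T].
Proof.
apply/and3P; split.
- apply/eqP/setP => x; rewrite inE; apply/bigcupP; exists (porbit a x); last exact: porbit_id.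
  exact: imset_f.
- apply/trivIsetP => _ _ /imsetP[x _ ->] /imsetP[y _ ->]; apply: contraR.
  case/pred0Pn => z /andP[]; rewrite /= -!eq_porbit_mem => /eqP <- /eqP <-; exact: eqxx.
by apply/imsetP => -[x _ /setP/(_ x)]; rewrite porbit_id inE.
Qed.

(** The factors are the restrictions of [a] to its orbits, which partition [T] into blocks of [k]
    points. *)
Lemma disjoint_product_porbits k (P : {perm T} -> Prop) :
    0 < k -> (forall x, #|porbit a x| = k) ->
    (forall x, P (restr_perm (porbit a x) a)) ->
  k %| #|T| /\ disjoint_product (#|T| %/ k) P a.
Proof.
move=> k_gt0 card_k P_restr.
have card_T : #|T| = (#|porbits a| * k)%N.
  rewrite -cardsT; apply: card_uniform_partition porbits_partition.
  by move=> _ /imsetP[x _ ->].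
rewrite card_T dvdn_mull // mulnK //; split=> //.
pose S (i : 'I_#|porbits a|) := enum_val i.
have SP i : exists x, S i = porbit a x.
  by case/imsetP: (enum_valP i) => x _; exists x.
exists (fun i => restr_perm (S i) a).
have disj i x : x \in S i -> S i = porbit a x.
  by have [y ->] := SP i; rewrite -eq_porbit_mem => /eqP.
have restrE i x : restr_perm (S i) a x = if x \in S i then a x else x.
  by have [y ->] := SP i; rewrite porbit_restr.
split.
- by move=> i; have [x ->] := SP i.
- move=> i j; apply: contraR => /pred0Pn[x /andP[]]; rewrite /= !inE !restrE.
  case: ifP => [/disj Si _|]; last by rewrite eqxx.
  case: ifP => [/disj Sj _|]; last by rewrite eqxx.
  by apply/eqP/enum_val_inj; rewrite -/(S i) -/(S j) Si.
apply/permP => x.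
have [i x_i] : exists i, x \in S i.
  have a_x : porbit a x \in porbits a by exact: imset_f.
  by exists (enum_rank_in a_x (porbit a x)); rewrite /S enum_rankK_in ?porbit_id.
(* Only the factor belonging to the orbit of [x] moves [x]. It sends [x] to [a x] in the same orbit,
   which the remaining factors fix by [out]. *)
have prodE (r : seq 'I_#|porbits a|) : uniq r ->
    (\prod_(j <- r) restr_perm (S j) a) x = if i \in r then a x else x.
  have ax_i : a x \in S i by rewrite (disj _ _ x_i) (mem_porbit a 1).
  have S_uniq j y : y \in S i -> (y \in S j) = (j == i).
    move=> y_i; apply/idP/eqP => [y_j|-> //]; apply: enum_val_inj.
    by rewrite -/(S i) -/(S j) (disj _ _ y_i) (disj _ _ y_j).
  have out (q : seq 'I_#|porbits a|) y : y \in S i -> i \notin q -> (\prod_(j <- q) restr_perm (S j) a) y = y.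
    move=> y_i; elim: q => [|j q IH]; first by rewrite big_nil perm1.
    rewrite inE negb_or big_cons permM restrE S_uniq // eq_sym => /andP[/negbTE-> /IH].
    by [].
  elim: r => [|j r IH]; first by rewrite big_nil perm1.
  rewrite /= big_cons permM restrE S_uniq // inE (eq_sym i) => /andP[j_r /IH].
  by case: eqP j_r => [-> i_r _|_ _ ->] //; rewrite out.
by rewrite prodE ?index_enum_uniq // mem_index_enum.
Qed.

Lemma porbit_mem x : (x \in porbit a x) * (a x \in porbit a x) * (a (a x) \in porbit a x).
Proof.
rewrite porbit_id (mem_porbit a 1); have := mem_porbit a 2 x.
by rewrite expgS expg1 permM => ->.
Qed.

Lemma disjoint_transpositions : fixed_point_free a -> inv2 a ->
  2 %| #|T| /\ disjoint_product (#|T| %/ 2) (@is_transposition T) a.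
Proof.
move=> a0 a2; apply: disjoint_product_porbits => // x.
  apply: (card_porbit_seq (s := [:: x; a x])); rewrite ?inE ?eqxx //=.
  - by rewrite inE eq_sym a0.
  - by move=> z; rewrite !inE => /orP[]/eqP->; rewrite ?a2 eqxx ?orbT.
  by move=> z; rewrite !inE => /orP[]/eqP->; rewrite porbit_mem.
exists x, (a x); split; first by rewrite eq_sym.
apply/permP=> z; rewrite porbit_restr; case: tpermP => [->|->|zx zax].
- by rewrite porbit_mem.
- by rewrite porbit_mem a2.
case: ifP => // /porbitP[i def_z].
suff: z \in [:: x; a x] by rewrite !inE => /orP[]/eqP.
rewrite {zx zax}def_z; elim: i => [|i]; first by rewrite perm1 inE eqxx.
by rewrite expgSr permM !inE => /orP[]/eqP->; rewrite ?a2 eqxx ?orbT.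
Qed.

Lemma disjoint_3_cycles : fixed_point_free a -> inv3 a ->
  3 %| #|T| /\ disjoint_product (#|T| %/ 3) (@is_cycle 3 T) a.
Proof.
move=> a0 a3; have a2 z : a (a z) <> z.
  by move=> a2; have /eqP[] := a0 z; rewrite -{1}a2 a3.
have uniq_x x : uniq [:: x; a x; a (a x)].
  by have a2x := a2 x; have a3x := a3 x; have /eqP ax := a0 x; uniq_inj.
have closed_x x z : z \in [:: x; a x; a (a x)] -> a z \in [:: x; a x; a (a x)].
  by rewrite !inE => /or3P[]/eqP->; rewrite ?a3 eqxx ?orbT.
apply: disjoint_product_porbits => // x.
  apply: (card_porbit_seq (s := [:: x; a x; a (a x)])); rewrite ?inE ?eqxx //.
    exact: closed_x.
  by move=> z; rewrite !inE => /or3P[]/eqP->; rewrite porbit_mem.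
apply: (is_cycle3 (u := x)); rewrite ?porbit_restr ?porbit_mem ?a3 //.
move=> z z_x; rewrite porbit_restr; case: ifP => // /porbitP[i def_z].
case/negP: z_x; rewrite {z}def_z; elim: i => [|i]; first by rewrite perm1 inE eqxx.
by rewrite expgSr permM; exact: closed_x.
Qed.

End Decomposition.

(** The second member of an exceptional pair moves at most three points, so with more than five
    letters it fixes one. *)
Lemma fpf_not_exceptional (T : finType) (a b : {perm T}) :
  5 < #|T| -> fixed_point_free a -> ~ exceptional b a.
Proof.
move=> T_gt5 a0 [_ exc].
have {exc}: is_transposition a \/ is_cycle 3 a by case: exc => -[_]; auto.
case=> [/(transposition_fix T_gt5)[z az]|[c [uc ac]]].
  by have := a0 z; rewrite az eqxx.
have [|z z_c] := fresh5 T_gt5 (s := c); first by rewrite size_tuple.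
by have := a0 z; rewrite ac next_nth (negbTE z_c) eqxx.
Qed.

Theorem theorem1 (n : nat) (alpha beta : 'S_n) (n_gt5 : 5 < n)
    (alpha_neq1 : alpha <> 1%g) (beta_neq1 : beta <> 1%g) :
  [/\ 2 <= eta [set: 'S_n]%G alpha beta,
      eta [set: 'S_n]%G alpha beta = 2 ->
        fixed_point_free alpha \/ fixed_point_free beta
    & eta [set: 'S_n]%G alpha beta = 2 -> fixed_point_free alpha ->
        [/\ 2 %| n, disjoint_product (n %/ 2) (@is_transposition _) alpha
          & is_transposition beta \/ is_cycle 3 beta]
        \/
        [/\ 3 %| n, disjoint_product (n %/ 3) (@is_cycle 3 _) alpha
          & is_transposition beta]].
Proof.
have T_gt5 : 5 < #|'I_n| by rewrite card_ord.
case: (eta_dichotomy T_gt5 alpha_neq1 beta_neq1) => [eta_gt2 | [eta_gt1 exc]].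
  by split=> [|eta2|eta2]; [exact: ltnW | move: eta_gt2; rewrite eta2 ..].
split=> // [_ | _ alpha0]; first by case: exc => -[]; [left | right].
case: exc => [[_ exc] | /fpf_not_exceptional]; last by case.
have := @disjoint_transpositions _ alpha alpha0.
have := @disjoint_3_cycles _ alpha alpha0.
rewrite card_ord => prod3 prod2.
by case: exc => -[a_inv b_type]; [left; case: (prod2 a_inv) | right; case: (prod3 a_inv)].
Qed.
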